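(* Let $N>100$ be an integer, and let $m=(N+1)/2$ if $N$ is odd and $m=N/2$ if $N$ is even. Let $x_1>x_2>\dots>x_N$ be the unique strictly decreasing solution with zero median (equivalently, with $x_1+\dots+x_N=0$) of the recursion $$x_{n+1}=x_n-\frac{1}{x_1+\cdots+x_n},\qquad 1\le n\le N-1,$$ and let $S_n=\sum_{i=1}^n x_i$ for $1\le n\le N$. Then: (a) $0\le x_m\le \dfrac1m$. (b) For $1\le n\le m-1$, $$x_n\le \sqrt{2(1+\log(m/n))}$$ and $$\left(\frac{n(n+1)}{2}\right)^{1/2}\le S_n\le \frac{3n}{2}\sqrt{2(1+\log(m/n))}.$$ (c) For $1\le n\le \lfloor m/e^3\rfloor$, $$x_n\ge \frac13\sqrt{2(1+\log(m/n))}\quad\text{and}\quad S_n\ge \frac n3\sqrt{2(1+\log(m/n))}.$$ (d) For $1\le i<j\le \lfloor m/e^3\rfloor$, $$x_i^2-x_j^2\ge \frac{4\log(j/i)}{9}.$$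
   Context: Zero median means $x_m=0$ if $N$ is odd and $x_m=-x_{m+1}$ if $N$ is even. It is known (McKeague and Levin) that the recursion has exactly one strictly decreasing solution with $x_1+\dots+x_N=0$, that this solution has zero median, that every zero-median solution has zero mean, and that it satisfies $x_1^2+\dots+x_N^2=N-1$ and $x_n=-x_{N+1-n}$ for $1\le n\le N$. The symbol $\log$ denotes the natural logarithm and $\lfloor x\rfloor$ the greatest integer at most $x$. *)

(* Defs.v *)
(* Real analysis over Stdlib's [R], with Coquelicot's finite sums. *)
From Stdlib Require Export Reals ZArith Arith.
From Coquelicot Require Export Coquelicot.
Open Scope R_scope.

(* A finite sequence x_1, ..., x_N is a function [nat -> R] of which only the
   values at 1, ..., N matter.  [partial_sum x n] is x_1 + ... + x_n. *)
Definition partial_sum (x : nat -> R) (n : nat) : R := sum_n_m x 1 n.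

(* (N+1)/2 for odd N and N/2 for even N; the divisions are exact. *)
Definition median_index (N : nat) : nat :=
  if Nat.odd N then ((N + 1) / 2)%nat else (N / 2)%nat.

(* [/ 0] is an unspecified real in Stdlib, so the nonvanishing of the
   denominators, implicit on paper, is part of being a solution. *)
Definition recursion_solution (N : nat) (x : nat -> R) : Prop :=
  forall n : nat, (1 <= n <= N - 1)%nat ->
    partial_sum x n <> 0 /\ x (n + 1)%nat = x n - 1 / partial_sum x n.

Definition strictly_decreasing (N : nat) (x : nat -> R) : Prop :=
  forall i j : nat, (1 <= i)%nat -> (i < j)%nat -> (j <= N)%nat -> x j < x i.

Definition zero_median (N : nat) (x : nat -> R) : Prop :=
  let m := median_index N in
  if Nat.odd N then x m = 0 else x m = - x (m + 1)%nat.

(* Main.v *)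
(** Write [D_n = S_n - n x_n].  The recursion gives [D_(n+1) = D_n + n / S_n],
    and since [S_n] increases while [S_n / n] decreases on the nonnegative
    half, induction yields [n(n-1)/2 <= S_n D_n <= n(n-1)].  The left bound,
    with [S_n x_n >= 1], is the lower bound on [S_n]; the right one controls
    [S_n / n] in terms of [x_n].

    Moreover [x_n^2 - x_(n+1)^2 = (x_n + x_(n+1)) / S_n].  By [S_n >= n x_n]
    this is at most [2/n], and summing down from [m] bounds [x_n^2] from above.
    Conversely [S_m <= m] forces [x_n >= (m - n)/m], so [x_n >= 2/3] for
    [n <= m/3]; then [S_n <= (9/4) n x_n] and the difference is at least
    [4/(9n)].  Summing gives (d), and (c) follows by starting the sum at
    [floor (m/3) >= m/4]. *)

Require Import Defs.
From Stdlib Require Import Lra Lia.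

(* The nonnegative half of a solution.  The last field covers both parities:
   [x m = 0] for odd [N], and [x m = 1 / (2 s m)] for even [N]. *)
Record half_solution (m : nat) (x s : nat -> R) : Prop := {
  half_sum_1 : s 1%nat = x 1%nat;
  half_sum_S : forall n, (1 <= n < m)%nat -> s (n + 1)%nat = s n + x (n + 1)%nat;
  half_sum_pos : forall n, (1 <= n <= m)%nat -> 0 < s n;
  half_step : forall n, (1 <= n < m)%nat -> x n = x (n + 1)%nat + / s n;
  half_end_ge0 : 0 <= x m;
  half_end_le : x m * s m <= 1 / 2 }.

Lemma INR_add1 (n : nat) : INR (n + 1) = INR n + 1.
Proof. now rewrite plus_INR. Qed.

Lemma INR_ge1 (n : nat) : (1 <= n)%nat -> 1 <= INR n.
Proof. intros H; apply le_INR in H; exact H. Qed.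

Lemma ln_le_sub1 (t : R) : 0 < t -> ln t <= t - 1.
Proof.
intros Ht; generalize (exp_ineq1_le (ln t)); rewrite exp_ln by exact Ht; lra.
Qed.

Lemma ln_succ_le (t : R) : 0 < t -> ln (t + 1) - ln t <= / t.
Proof.
intros Ht; rewrite <- ln_div by lra.
assert (H : 0 < (t + 1) / t) by (apply Rdiv_lt_0_compat; lra).
apply ln_le_sub1 in H.
replace ((t + 1) / t - 1) with (/ t) in H by (field; lra); exact H.
Qed.

Lemma ln_succ_ge (t : R) : 0 < t -> / (t + 1) <= ln (t + 1) - ln t.
Proof.
intros Ht.
assert (H : 0 < t / (t + 1)) by (apply Rdiv_lt_0_compat; lra).
apply ln_le_sub1 in H; rewrite ln_div in H by lra.
replace (t / (t + 1) - 1) with (- / (t + 1)) in H by (field; lra); lra.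
Qed.

Lemma partial_sum_1 (x : nat -> R) : partial_sum x 1 = x 1%nat.
Proof. apply sum_n_n. Qed.

Lemma partial_sum_add1 (x : nat -> R) (n : nat) :
  partial_sum x (n + 1) = partial_sum x n + x (n + 1)%nat.
Proof.
unfold partial_sum; rewrite Nat.add_1_r, sum_n_Sm by lia; reflexivity.
Qed.

Lemma half_anti (m : nat) (x s : nat -> R) (H : half_solution m x s) (i d : nat) :
  (1 <= i)%nat -> (i + d <= m)%nat -> x (i + d)%nat <= x i.
Proof.
intros Hi; induction d as [|d IH]; intros Hd.
- rewrite Nat.add_0_r; lra.
- assert (IH' := IH ltac:(lia)).
  assert (E := half_step _ _ _ H (i + d)%nat ltac:(lia)).
  assert (P := Rinv_0_lt_compat _ (half_sum_pos _ _ _ H (i + d)%nat ltac:(lia))).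
  replace (i + Datatypes.S d)%nat with (i + d + 1)%nat by lia; lra.
Qed.

Lemma half_ge0 (m : nat) (x s : nat -> R) (H : half_solution m x s) (n : nat) :
  (1 <= n <= m)%nat -> 0 <= x n.
Proof.
intros Hn; assert (A := half_anti _ _ _ H n (m - n) ltac:(lia) ltac:(lia)).
replace (n + (m - n))%nat with m in A by lia.
assert (B := half_end_ge0 _ _ _ H); lra.
Qed.

Lemma half_sum_ge (m : nat) (x s : nat -> R) (H : half_solution m x s) (n : nat) :
  (1 <= n <= m)%nat -> INR n * x n <= s n.
Proof.
destruct n as [|n]; [lia|]; induction n as [|n IH]; intros Hn.
- rewrite (half_sum_1 _ _ _ H); simpl; lra.
- assert (IH' := IH ltac:(lia)).
  assert (A := half_anti _ _ _ H (Datatypes.S n) 1 ltac:(lia) ltac:(lia)).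
  replace (Datatypes.S (Datatypes.S n)) with (Datatypes.S n + 1)%nat in * by lia.
  rewrite (half_sum_S _ _ _ H) by lia; rewrite INR_add1.
  assert (P := pos_INR (Datatypes.S n)); nra.
Qed.

Lemma half_sum_mono (m : nat) (x s : nat -> R) (H : half_solution m x s) (i d : nat) :
  (1 <= i)%nat -> (i + d <= m)%nat -> s i <= s (i + d)%nat.
Proof.
intros Hi; induction d as [|d IH]; intros Hd.
- rewrite Nat.add_0_r; lra.
- assert (IH' := IH ltac:(lia)).
  replace (i + Datatypes.S d)%nat with (i + d + 1)%nat by lia.
  rewrite (half_sum_S _ _ _ H) by lia.
  assert (P := half_ge0 _ _ _ H (i + d + 1)%nat ltac:(lia)); lra.
Qed.

Lemma half_excess_bounds (m : nat) (x s : nat -> R) (H : half_solution m x s) (n : nat) :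
  (1 <= n <= m)%nat ->
  INR n * (INR n - 1) / 2 <= s n * (s n - INR n * x n) <= INR n * (INR n - 1).
Proof.
destruct n as [|n]; [lia|]; induction n as [|n IH]; intros Hn.
- rewrite (half_sum_1 _ _ _ H); simpl; lra.
- replace (Datatypes.S (Datatypes.S n)) with (Datatypes.S n + 1)%nat in * by lia.
  set (k := Datatypes.S n) in *.
  assert (IH' := IH ltac:(lia)); clear IH.
  assert (Hk := INR_ge1 k ltac:(lia)).
  assert (Hs := half_sum_pos _ _ _ H k ltac:(lia)).
  assert (E := half_step _ _ _ H k ltac:(lia)).
  assert (Hx := half_ge0 _ _ _ H (k + 1)%nat ltac:(lia)).
  assert (Hge := half_sum_ge _ _ _ H k ltac:(lia)).
  rewrite (half_sum_S _ _ _ H) by lia; rewrite INR_add1.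
  assert (Hi : s k * / s k = 1) by (field; lra).
  assert (Hp := Rinv_0_lt_compat _ Hs).
  rewrite E in IH', Hge; clear E.
  generalize dependent (/ s k); generalize dependent (x (k + 1)%nat).
  generalize dependent (s k); generalize dependent (INR k).
  clear; intros a Ha c Hc y Hy q IH Hge Hq Hqp.
  set (D := c - a * y).
  assert (HD : a * (a - 1) / 2 + a <= c * D <= a * (a - 1) + a)
    by (unfold D; split; nra).
  replace (c + y - (a + 1) * y) with D by (unfold D; ring).
  assert (HDp : 0 <= D) by (unfold D; nra).
  assert (HyD : 0 <= y * D) by (now apply Rmult_le_pos).
  split; [nra|].
  (* [(c + y) D <= (1 + 1/a) c D], since [a y <= c] *)
  assert (Hay : a * y <= c) by (unfold D in HDp; lra).
  apply Rmult_le_reg_l with a; [lra|].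
  assert (a * y * D <= c * D) by (now apply Rmult_le_compat_r).
  nra.
Qed.

Lemma half_sum_lower (m : nat) (x s : nat -> R) (H : half_solution m x s) (n : nat) :
  (1 <= n < m)%nat -> sqrt (INR n * (INR n + 1) / 2) <= s n.
Proof.
intros Hn.
assert (B := proj1 (half_excess_bounds _ _ _ H n ltac:(lia))).
assert (Hs := half_sum_pos _ _ _ H n ltac:(lia)).
assert (E := half_step _ _ _ H n ltac:(lia)).
assert (Hx := half_ge0 _ _ _ H (n + 1)%nat ltac:(lia)).
assert (Hn1 := INR_ge1 n ltac:(lia)).
assert (Hi : s n * / s n = 1) by (field; lra).
assert (H1 : 1 <= s n * x n) by (rewrite E; nra).
rewrite <- (sqrt_square (s n)) by lra.
apply sqrt_le_1_alt; nra.
Qed.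

Lemma half_end_le_inv (m : nat) (x s : nat -> R) (H : half_solution m x s) :
  (1 <= m)%nat -> x m <= / INR m.
Proof.
intros Hm.
assert (Hge := half_sum_ge _ _ _ H m ltac:(lia)).
assert (Hx := half_end_ge0 _ _ _ H).
assert (He := half_end_le _ _ _ H).
assert (B := proj1 (half_excess_bounds _ _ _ H m ltac:(lia))).
assert (Hs := half_sum_pos _ _ _ H m ltac:(lia)).
assert (Hm1 := INR_ge1 m ltac:(lia)).
destruct (Rle_or_lt (x m) (/ INR m)) as [C|C]; [exact C|exfalso].
assert (Hp : 0 < / INR m) by (apply Rinv_0_lt_compat; lra).
assert (D : 1 < INR m * x m).
{ apply Rmult_lt_compat_l with (r := INR m) in C; [|lra].
  rewrite Rinv_r in C by lra; exact C. }
nra.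
Qed.

Lemma half_sq_upper (m : nat) (x s : nat -> R) (H : half_solution m x s) (d n : nat) :
  (1 <= n)%nat -> (n + d = m)%nat ->
  x n * x n <= 2 * / INR n + 2 * (ln (INR m) - ln (INR n)).
Proof.
revert n; induction d as [|d IH]; intros n Hn Hd.
- rewrite Nat.add_0_r in Hd; subst n.
  assert (A := half_end_le_inv _ _ _ H ltac:(lia)).
  assert (Hx := half_end_ge0 _ _ _ H).
  assert (Hm1 := INR_ge1 m ltac:(lia)).
  assert (0 < / INR m <= 1).
  { split; [apply Rinv_0_lt_compat; lra|].
    rewrite <- Rinv_1; apply Rinv_le_contravar; lra. }
  nra.
- assert (IH' := IH (n + 1)%nat ltac:(lia) ltac:(lia)).
  rewrite INR_add1 in IH'.
  assert (Hn1 := INR_ge1 n ltac:(lia)).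
  assert (L := ln_succ_ge (INR n) ltac:(lra)).
  assert (E := half_step _ _ _ H n ltac:(lia)).
  assert (Hs := half_sum_pos _ _ _ H n ltac:(lia)).
  assert (Hge := half_sum_ge _ _ _ H n ltac:(lia)).
  assert (Hx := half_ge0 _ _ _ H (n + 1)%nat ltac:(lia)).
  assert (Hp := Rinv_0_lt_compat _ Hs).
  assert (F : x n * / s n <= / INR n).
  { apply Rmult_le_reg_l with (INR n); [lra|].
    rewrite Rinv_r by lra.
    apply Rmult_le_reg_r with (s n); [lra|].
    replace (INR n * (x n * / s n) * s n) with (INR n * x n) by (field; lra); lra. }
  assert (G : x n * x n = x (n + 1)%nat * x (n + 1)%nat
              + 2 * (x n * / s n) - / s n * / s n) by (rewrite E; ring).
  nra.
Qed.

Lemma half_upper (m : nat) (x s : nat -> R) (H : half_solution m x s) (n : nat) :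
  (1 <= n <= m)%nat -> x n <= sqrt (2 * (1 + ln (INR m / INR n))).
Proof.
intros Hn.
assert (Hn1 := INR_ge1 n ltac:(lia)).
assert (Hm1 := INR_ge1 m ltac:(lia)).
assert (A := half_sq_upper _ _ _ H (m - n) n ltac:(lia) ltac:(lia)).
rewrite <- (sqrt_square (x n)) by (apply (half_ge0 _ _ _ H); lia).
apply sqrt_le_1_alt; rewrite ln_div by lra.
assert (/ INR n <= 1) by (rewrite <- Rinv_1; apply Rinv_le_contravar; lra).
lra.
Qed.

Lemma half_sum_upper (m : nat) (x s : nat -> R) (H : half_solution m x s) (n : nat) :
  (1 <= n <= m)%nat ->
  s n <= 3 * INR n / 2 * sqrt (2 * (1 + ln (INR m / INR n))).
Proof.
intros Hn.
assert (Hn1 := INR_ge1 n ltac:(lia)).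
assert (Hnm : INR n <= INR m) by (apply le_INR; lia).
assert (A := half_upper _ _ _ H n Hn).
assert (B := proj2 (half_excess_bounds _ _ _ H n Hn)).
assert (Hs := half_sum_pos _ _ _ H n Hn).
assert (L : 0 <= ln (INR m / INR n)).
{ rewrite ln_div by lra.
  assert (ln (INR n) <= ln (INR m)) by (apply ln_le; lra); lra. }
assert (G := sqrt_sqrt (2 * (1 + ln (INR m / INR n))) ltac:(lra)).
assert (Gp := sqrt_pos (2 * (1 + ln (INR m / INR n)))).
set (g := sqrt _) in *.
assert (G2 : 2 <= g * g) by lra.
clearbody g; clear G L.
destruct (Rle_or_lt (s n) (3 * INR n / 2 * g)) as [C|C]; [exact C|exfalso].
assert (M1 : 0 <= (s n - 3 * INR n / 2 * g) * (s n - INR n * g + 3 * INR n / 2 * g))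
  by (apply Rmult_le_pos; nra).
assert (M2 : s n * (INR n * x n) <= s n * (INR n * g))
  by (apply Rmult_le_compat_l; nra).
assert (M3 : 2 * (INR n * INR n) <= g * g * (INR n * INR n))
  by (apply Rmult_le_compat_r; nra).
nra.
Qed.

Lemma half_sum_end_le (m : nat) (x s : nat -> R) (H : half_solution m x s) :
  (1 <= m)%nat -> s m <= INR m.
Proof.
intros Hm.
assert (B := proj2 (half_excess_bounds _ _ _ H m ltac:(lia))).
assert (He := half_end_le _ _ _ H).
assert (Hs := half_sum_pos _ _ _ H m ltac:(lia)).
assert (Hm1 := INR_ge1 m ltac:(lia)).
nra.
Qed.

Lemma half_lower_linear (m : nat) (x s : nat -> R) (H : half_solution m x s) (d n : nat) :
  (1 <= n)%nat -> (n + d = m)%nat -> INR d * / INR m <= x n.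
Proof.
revert n; induction d as [|d IH]; intros n Hn Hd.
- assert (A := half_ge0 _ _ _ H n ltac:(lia)); simpl; lra.
- assert (IH' := IH (n + 1)%nat ltac:(lia) ltac:(lia)).
  rewrite (half_step _ _ _ H n) by lia.
  assert (Hs := half_sum_pos _ _ _ H n ltac:(lia)).
  assert (M := half_sum_mono _ _ _ H n (Datatypes.S d) ltac:(lia) ltac:(lia)).
  rewrite Hd in M.
  assert (E := half_sum_end_le _ _ _ H ltac:(lia)).
  assert (/ INR m <= / s n) by (apply Rinv_le_contravar; lra).
  rewrite S_INR; lra.
Qed.

Lemma half_ge_two_thirds (m : nat) (x s : nat -> R) (H : half_solution m x s) (n : nat) :
  (1 <= n)%nat -> (3 * n <= m)%nat -> 2 / 3 <= x n.
Proof.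
intros Hn Hnm.
assert (A := half_lower_linear _ _ _ H (m - n) n Hn ltac:(lia)).
rewrite minus_INR in A by lia.
apply le_INR in Hnm; rewrite mult_INR in Hnm; simpl in Hnm.
assert (Hn1 := INR_ge1 n Hn).
assert (E : (INR m - INR n) * / INR m = 1 - INR n * / INR m) by (field; lra).
assert (INR n * / INR m <= 1 / 3).
{ apply Rmult_le_reg_r with (INR m); [lra|].
  rewrite Rmult_assoc, Rinv_l by lra; lra. }
lra.
Qed.

Lemma half_sq_step (m : nat) (x s : nat -> R) (H : half_solution m x s) (n : nat) :
  (1 <= n)%nat -> (3 * n <= m)%nat ->
  4 / 9 * (ln (INR n + 1) - ln (INR n)) <= x n * x n - x (n + 1)%nat * x (n + 1)%nat.
Proof.
intros Hn Hnm.
assert (Hx := half_ge_two_thirds _ _ _ H n Hn Hnm).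
assert (Hy := half_ge0 _ _ _ H (n + 1)%nat ltac:(lia)).
assert (B := proj2 (half_excess_bounds _ _ _ H n ltac:(lia))).
assert (Hs := half_sum_pos _ _ _ H n ltac:(lia)).
assert (E := half_step _ _ _ H n ltac:(lia)).
assert (Hn1 := INR_ge1 n Hn).
assert (L := ln_succ_le (INR n) ltac:(lra)).
assert (Hp := Rinv_0_lt_compat _ Hs).
assert (U : s n <= 9 / 4 * (INR n * x n)).
{ destruct (Rle_or_lt (s n) (9 / 4 * (INR n * x n))) as [C|C]; [exact C|exfalso].
  assert (Hnx : 2 / 3 * INR n <= INR n * x n) by nra.
  nra. }
assert (F : 4 / 9 * / INR n <= x n * / s n).
{ apply Rmult_le_reg_r with (s n * INR n); [nra|].
  replace (4 / 9 * / INR n * (s n * INR n)) with (4 / 9 * s n) by (field; lra).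
  replace (x n * / s n * (s n * INR n)) with (INR n * x n) by (field; lra).
  lra. }
assert (G : x n * x n - x (n + 1)%nat * x (n + 1)%nat
            = x n * / s n + x (n + 1)%nat * / s n) by (rewrite E; ring).
nra.
Qed.

Lemma half_sq_diff (m : nat) (x s : nat -> R) (H : half_solution m x s) (i d : nat) :
  (1 <= i)%nat -> (3 * (i + d) <= m)%nat ->
  4 / 9 * (ln (INR (i + d)) - ln (INR i)) <= x i * x i - x (i + d)%nat * x (i + d)%nat.
Proof.
intros Hi; induction d as [|d IH]; intros Hd.
- rewrite Nat.add_0_r; lra.
- assert (IH' := IH ltac:(lia)).
  assert (A := half_sq_step _ _ _ H (i + d) ltac:(lia) ltac:(lia)).
  replace (i + Datatypes.S d)%nat with (i + d + 1)%nat by lia.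
  rewrite INR_add1; lra.
Qed.

Lemma exp_2_ge4 : 4 <= exp 2.
Proof.
replace 2 with (1 + 1) by ring; rewrite exp_plus.
assert (A := exp_ineq1_le 1); nra.
Qed.

Lemma exp_3_ge8 : 8 <= exp 3.
Proof.
replace 3 with (1 + 2) by ring; rewrite exp_plus.
assert (A := exp_ineq1_le 1); assert (B := exp_2_ge4); nra.
Qed.

Lemma le_Zfloor_div (n : nat) (a e : R) : 0 < e ->
  (Z.of_nat n <= Zfloor (a / e))%Z -> INR n * e <= a.
Proof.
intros He H; apply IZR_le in H; rewrite <- INR_IZR_INZ in H.
assert (B := proj1 (Zfloor_bound (a / e))).
apply Rmult_le_reg_r with (/ e); [now apply Rinv_0_lt_compat|].
rewrite Rmult_assoc, Rinv_r by lra; unfold Rdiv in *; lra.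
Qed.

Lemma half_lower (m : nat) (x s : nat -> R) (H : half_solution m x s) (n : nat) :
  (9 <= m)%nat -> (1 <= n)%nat -> INR n * exp 3 <= INR m ->
  1 / 3 * sqrt (2 * (1 + ln (INR m / INR n))) <= x n.
Proof.
intros Hm Hn He.
assert (Hn1 := INR_ge1 n Hn).
assert (E3 := exp_3_ge8).
assert (H8 : (8 * n <= m)%nat).
{ apply INR_le; rewrite mult_INR; replace (INR 8) with 8 by (simpl; lra); nra. }
pose (k := (m / 3)%nat).
assert (K1 : (3 * k <= m)%nat) by (apply Nat.Div0.mul_div_le).
assert (K2 : (m < 3 * k + 3)%nat).
{ unfold k; assert (Q := Nat.div_mod_eq m 3).
  assert (Q' := Nat.mod_upper_bound m 3 ltac:(lia)); lia. }
assert (K3 : (m <= 4 * k)%nat) by lia.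
assert (A := half_sq_diff _ _ _ H n (k - n) Hn ltac:(lia)).
replace (n + (k - n))%nat with k in A by lia.
assert (X := half_ge_two_thirds _ _ _ H k ltac:(lia) K1).
assert (Hk1 := INR_ge1 k ltac:(lia)).
assert (Hm1 := INR_ge1 m ltac:(lia)).
assert (L1 : ln (INR m) <= 2 + ln (INR k)).
{ apply le_INR in K3; rewrite mult_INR in K3.
  replace (INR 4) with 4 in K3 by (simpl; lra).
  rewrite <- (ln_exp 2), <- ln_mult by (try apply exp_pos; lra).
  assert (E2 := exp_2_ge4); apply ln_le; nra. }
assert (L2 : ln (INR n) + 3 <= ln (INR m)).
{ rewrite <- (ln_exp 3) at 1; rewrite <- ln_mult by (try apply exp_pos; lra).
  apply ln_le; nra. }
rewrite ln_div by lra.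
assert (G := sqrt_sqrt (2 * (1 + (ln (INR m) - ln (INR n)))) ltac:(lra)).
assert (Gp := sqrt_pos (2 * (1 + (ln (INR m) - ln (INR n))))).
set (g := sqrt _) in *.
apply Rsqr_incr_0_var; [|apply (half_ge0 _ _ _ H); lia].
unfold Rsqr; nra.
Qed.

Lemma median_index_spec (N : nat) :
  if Nat.odd N then N = (2 * median_index N - 1)%nat /\ (1 <= median_index N)%nat
  else N = (2 * median_index N)%nat.
Proof.
unfold median_index; destruct (Nat.odd N) eqn:O.
- apply Nat.odd_spec in O; destruct O as [q ->].
  replace (2 * q + 1 + 1)%nat with ((q + 1) * 2)%nat by lia.
  rewrite Nat.div_mul by lia; lia.
- assert (V : Nat.even N = true) by (rewrite <- Nat.negb_odd, O; reflexivity).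
  apply Nat.even_spec in V; destruct V as [q ->].
  replace (2 * q)%nat with (q * 2)%nat at 2 by lia.
  rewrite Nat.div_mul by lia; lia.
Qed.

Lemma half_of_solution (N : nat) (x S : nat -> R) :
  (2 < N)%nat -> recursion_solution N x -> strictly_decreasing N x ->
  zero_median N x ->
  (forall n : nat, (1 <= n <= N)%nat -> S n = partial_sum x n) ->
  half_solution (median_index N) x S.
Proof.
intros HN Hrec Hdec Hmed HS.
assert (Sp := median_index_spec N).
unfold zero_median in Hmed; cbv zeta in Hmed.
set (m := median_index N) in *; clearbody m.
assert (Hm : (1 <= m < N)%nat) by (destruct (Nat.odd N); lia).
assert (Step : forall n, (1 <= n < N)%nat -> 0 < S n /\ x n = x (n + 1)%nat + / S n).
{ intros n Hn; destruct (Hrec n ltac:(lia)) as [Z E].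
  assert (D := Hdec n (n + 1)%nat ltac:(lia) ltac:(lia) ltac:(lia)).
  rewrite HS by lia; unfold Rdiv in E; rewrite Rmult_1_l in E.
  split; [|lra].
  rewrite <- (Rinv_inv (partial_sum x n)); apply Rinv_0_lt_compat; lra. }
destruct (Step m Hm) as [Ps Es].
assert (Hi : S m * / S m = 1) by (field; lra).
assert (Hp := Rinv_0_lt_compat _ Ps).
constructor.
- rewrite HS by lia; apply partial_sum_1.
- intros n Hn; rewrite !HS by lia; apply partial_sum_add1.
- intros n Hn; apply Step; lia.
- intros n Hn; apply Step; lia.
- destruct (Nat.odd N); lra.
- destruct (Nat.odd N); [rewrite Hmed; lra|].
  replace (x m) with (/ S m / 2) by lra; lra.
Qed.

Theorem lemma3p2 (N m : nat) (x S : nat -> R)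
  (HN : (100 < N)%nat)
  (Hm : m = median_index N)
  (Hrec : recursion_solution N x)
  (Hdec : strictly_decreasing N x)
  (Hmed : zero_median N x)
  (HS : forall n : nat, (1 <= n <= N)%nat -> S n = partial_sum x n) :
  (* (a) *)
  (0 <= x m <= 1 / INR m) /\
  (* (b) *)
  (forall n : nat, (1 <= n <= m - 1)%nat ->
     x n <= sqrt (2 * (1 + ln (INR m / INR n))) /\
     sqrt (INR n * (INR n + 1) / 2) <= S n
       <= 3 * INR n / 2 * sqrt (2 * (1 + ln (INR m / INR n)))) /\
  (* (c) *)
  (forall n : nat, (1 <= n)%nat ->
     (Z.of_nat n <= Zfloor (INR m / exp 3))%Z ->
     x n >= 1 / 3 * sqrt (2 * (1 + ln (INR m / INR n))) /\
     S n >= INR n / 3 * sqrt (2 * (1 + ln (INR m / INR n)))) /\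
  (* (d) *)
  (forall i j : nat, (1 <= i < j)%nat ->
     (Z.of_nat j <= Zfloor (INR m / exp 3))%Z ->
     (x i) ^ 2 - (x j) ^ 2 >= 4 * ln (INR j / INR i) / 9).
Proof.
assert (H := half_of_solution N x S ltac:(lia) Hrec Hdec Hmed HS).
assert (Sp := median_index_spec N).
rewrite <- Hm in H, Sp.
assert (Hm9 : (9 <= m)%nat) by (destruct (Nat.odd N); lia).
clear Hm Hrec Hdec Hmed HS Sp.
assert (E3 := exp_3_ge8).
assert (Small : forall n, (Z.of_nat n <= Zfloor (INR m / exp 3))%Z ->
                INR n * exp 3 <= INR m /\ (8 * n <= m)%nat).
{ intros n Hf; apply le_Zfloor_div in Hf; [|lra]; split; [exact Hf|].
  apply INR_le; rewrite mult_INR; replace (INR 8) with 8 by (simpl; lra).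
  assert (P := pos_INR n); nra. }
repeat split.
- exact (half_end_ge0 _ _ _ H).
- unfold Rdiv; rewrite Rmult_1_l; apply (half_end_le_inv _ _ _ H); lia.
- apply (half_upper _ _ _ H); lia.
- apply (half_sum_lower _ _ _ H); lia.
- apply (half_sum_upper _ _ _ H); lia.
- apply Rle_ge, (half_lower _ _ _ H); [lia|lia|now apply Small].
- destruct (Small n ltac:(assumption)) as [F1 F2].
  assert (A := half_lower _ _ _ H n ltac:(lia) ltac:(lia) F1).
  assert (B := half_sum_ge _ _ _ H n ltac:(lia)).
  assert (P := pos_INR n); nra.
- intros i j Hij Hf; destruct (Small j Hf) as [F1 F2].
  assert (A := half_sq_diff _ _ _ H i (j - i) ltac:(lia) ltac:(lia)).
  replace (i + (j - i))%nat with j in A by lia.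
  assert (I1 := INR_ge1 i ltac:(lia)).
  assert (J1 := INR_ge1 j ltac:(lia)).
  rewrite ln_div by lra; simpl; lra.
Qed.
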